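(* The geometric thickness of the complete bipartite graph $K_{6,8}$ is $\overline{\theta}(K_{6,8}) = 3$.
   Context: The geometric thickness $\overline{\theta}(G)$ of a graph $G$ is the smallest integer $k$ such that there is an injective placement of the vertices of $G$ at points of the plane, with each edge drawn as the straight line segment between the points of its endpoints and containing no other vertex point, together with an assignment of each edge to one of $k$ layers, such that no two edges assigned to the same layer cross (i.e., two edges in the same layer meet at most in a common endpoint). *)

(* Defs.v *)
From HB Require Import structures.
From mathcomp Require Import all_boot all_order all_algebra.
From mathcomp Require Import reals.
Set Implicit Arguments. Unset Strict Implicit. Unset Printing Implicit Defensive.
Import Order.TTheory GRing.Theory Num.Theory.
Local Open Scope ring_scope.

Definition point (R : realType) := (R * R)%type.

Definition on_seg (R : realType) (p q x : point R) : Prop :=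
  exists t : R, 0 <= t <= 1 /\
    x.1 = (1 - t) * p.1 + t * q.1 /\ x.2 = (1 - t) * p.2 + t * q.2.

Definition geom_drawable (R : realType) (V : finType) (adj : rel V) (k : nat)
  : Prop :=
  exists (pos : V -> point R) (layer : V -> V -> 'I_k),
    injective pos /\
    (forall u v, adj u v -> layer u v = layer v u) /\
    (forall u v w, adj u v -> w <> u -> w <> v ->
        ~ on_seg (pos u) (pos v) (pos w)) /\
    (forall a b c d, adj a b -> adj c d ->
        ~ ((a = c /\ b = d) \/ (a = d /\ b = c)) ->
        layer a b = layer c d ->
        forall x, on_seg (pos a) (pos b) x -> on_seg (pos c) (pos d) x ->
          exists w, (w = a \/ w = b) /\ (w = c \/ w = d) /\ x = pos w).

Definition is_geometric_thickness (R : realType) (V : finType) (adj : rel V)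
  (k : nat) : Prop :=
  geom_drawable R adj k /\ (forall j, geom_drawable R adj j -> (k <= j)%N).

Definition Kmn_adj (m n : nat) : rel ('I_m + 'I_n)%type :=
  fun u v => match u, v with
             | inl _, inr _ | inr _, inl _ => true
             | _, _ => false
             end.
Arguments Kmn_adj : clear implicits.

(* Main.v *)
(** In a drawing with two layers, perturb the points into general position.
Extend each layer to a maximal set of pairwise noncrossing segments, i.e. to a
triangulation. If an oriented edge has a point on its left, it bounds an empty
triangle on its left. Send each empty triangle to its middle vertex [m] in the
order of abscissas, together with the vertical direction that enters the
triangle at [m]: this is injective, and among the [2 |V|] such pairs at least
five are not reached, those at the leftmost and rightmost points and one at a
point farthest from the line through these two. A triangle has at most one
counterclockwise edge from red to blue, hence each triangulation has at most
[2 |V| - 5] edges that, oriented from red to blue, have a point on their left;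
likewise from blue to red. Count the former in the first triangulation and the
latter in the second. A hull edge belongs to both triangulations and has points
on one of its two sides, so all [m n] edges of [K_{m,n}] are counted and
[m n <= 2 (2 (m + n) - 5)]. This fails for [m, n = 6, 8]. *)

Require Import Defs.
From HB Require Import structures.
From mathcomp Require Import all_boot all_order all_algebra.
From mathcomp Require Import reals.
From mathcomp Require Import boolp.
From mathcomp Require Import ring lra zify.
Set Implicit Arguments. Unset Strict Implicit. Unset Printing Implicit Defensive.
Import Order.TTheory GRing.Theory Num.Theory.
Local Open Scope ring_scope.

(** * Orientations, crossings and affine parameters in the plane *)

Section Plane.
Variable R : realType.
Implicit Types a b c d e p q : point R.

(** Twice the signed area of the triangle, positive when it is counterclockwise. *)
Definition orient a b c : R :=
  (b.1 - a.1) * (c.2 - a.2) - (b.2 - a.2) * (c.1 - a.1).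

(** Only proper crossings count: segments that share an endpoint or overlap on a line have a
    vanishing orientation. *)
Definition cross a b c d : bool :=
  (orient a b c * orient a b d < 0) && (orient c d a * orient c d b < 0).

Definition lin (t : R) a b : point R :=
  ((1 - t) * a.1 + t * b.1, (1 - t) * a.2 + t * b.2).

Lemma on_segP a b e : on_seg a b e <-> exists2 t, 0 <= t <= 1 & e = lin t a b.
Proof.
split=> [[t [tb [e1 e2]]]|[t tb ->]]; last by exists t.
by exists t => //; rewrite [e]surjective_pairing e1 e2.
Qed.

Lemma lin_sym t a b : lin t a b = lin (1 - t) b a.
Proof. by rewrite /lin; congr pair; ring. Qed.

Lemma lin0 a b : lin 0 a b = a.
Proof. by rewrite [RHS]surjective_pairing /lin; congr pair; ring. Qed.

Lemma on_segC a b e : on_seg a b e -> on_seg b a e.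
Proof.
move=> /on_segP[t tb ->]; apply/on_segP; exists (1 - t); first lra.
exact: lin_sym.
Qed.

Lemma orient_lin t p q a b :
  orient p q (lin t a b) = (1 - t) * orient p q a + t * orient p q b.
Proof. by rewrite /orient /=; ring. Qed.

Lemma orient_cyc a b c : orient b c a = orient a b c.
Proof. by rewrite /orient; ring. Qed.

Lemma orient_swap a b c : orient b a c = - orient a b c.
Proof. by rewrite /orient; ring. Qed.

Lemma orient_swapr a b c : orient a c b = - orient a b c.
Proof. by rewrite /orient; ring. Qed.

Lemma orient_xxy a b : orient a a b = 0.
Proof. by rewrite /orient; ring. Qed.

Lemma orient_xyx a b : orient a b a = 0.
Proof. by rewrite /orient; ring. Qed.

Lemma orient_xyy a b : orient a b b = 0.
Proof. by rewrite /orient; ring. Qed.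

Lemma orient_split a b c e :
  orient a b c = orient a b e + orient b c e + orient c a e.
Proof. by rewrite /orient; ring. Qed.

Lemma orient_diff a b c d :
  orient a b c - orient a b d = orient c d b - orient c d a.
Proof. by rewrite /orient; ring. Qed.

(** The three-term Grassmann-Plücker relation. It serves to deduce the sign of one orientation
    around [u] from the signs of the others. *)
Lemma plucker u a b c d :
  orient u a b * orient u c d - orient u a c * orient u b d
    + orient u a d * orient u b c = 0.
Proof. by rewrite /orient; ring. Qed.

Lemma crossC a b c d : cross a b c d = cross c d a b.
Proof. by rewrite /cross andbC. Qed.

Lemma cross_swapr a b c d : cross a b d c = cross a b c d.
Proof. by rewrite /cross mulrC ![orient d c _]orient_swap mulrNN. Qed.

Lemma cross_swapl a b c d : cross b a c d = cross a b c d.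
Proof. by rewrite crossC cross_swapr crossC. Qed.

Lemma orient0_lin a b e : a <> b -> orient a b e = 0 -> exists t, e = lin t a b.
Proof.
move=> ab o0; have [b1|b1] := eqVneq b.1 a.1.
  have b2 : b.2 - a.2 != 0.
    rewrite subr_eq0; apply/eqP => b2; apply: ab.
    by rewrite [a]surjective_pairing [b]surjective_pairing b1 b2.
  exists ((e.2 - a.2) / (b.2 - a.2)); rewrite [e]surjective_pairing /lin /=.
  move: o0; rewrite /orient b1 subrr mul0r sub0r => /eqP.
  rewrite oppr_eq0 mulf_eq0 (negPf b2) /= subr_eq0 => /eqP e1.
  by congr pair; [rewrite e1; ring | field].
have {}b1 : b.1 - a.1 != 0 by rewrite subr_eq0.
exists ((e.1 - a.1) / (b.1 - a.1)); rewrite [e]surjective_pairing /lin /=.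
congr pair; first by field.
apply: (mulfI b1); apply/eqP; rewrite -subr_eq0; apply/eqP.
by rewrite -[RHS]o0 /orient; field.
Qed.

(** Each parameter is the zero of the orientation with respect to the other line, which is affine
    along the segment; both name the intersection point of the lines. *)
Lemma lines_meet a b c d : orient a b c != orient a b d ->
  lin (orient a b c / (orient a b c - orient a b d)) c d =
  lin (orient c d a / (orient c d a - orient c d b)) a b.
Proof.
rewrite -subr_eq0 => D0; have := orient_diff c d a b; rewrite -opprB => ->.
case: a b c d D0 => [a1 a2] [b1 b2] [c1 c2] [d1 d2].
rewrite /lin /orient /= => D0; congr pair; field;
  by rewrite D0 -oppr_eq0 opprB D0.
Qed.

Lemma ratio01 (x y : R) : x * y < 0 -> 0 < x / (x - y) < 1.
Proof.
move=> xy; have [D|D|D] := ltrgtP 0 (x - y); last by nra.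
- have x0 : 0 < x by nra.
  by rewrite divr_gt0 //= ltr_pdivrMr // mul1r; nra.
- have x0 : x < 0 by nra.
  by rewrite nmulr_rgt0 // invr_lt0 D /= ltr_ndivrMr // mul1r; nra.
Qed.

Lemma cross_point a b c d : cross a b c d ->
  exists r s, [/\ 0 < r < 1, 0 < s < 1 & lin s c d = lin r a b].
Proof.
move=> /andP[h1 h2]; do 2 eexists; split; last apply: lines_meet.
- exact: ratio01.
- exact: ratio01.
- by apply/eqP => h; nra.
Qed.

(* Two affine functions along a segment, both positive at its start and one of
   them negative at its end: the parameter at which the first of them vanishes. *)
Lemma first_exit (f0 f1 g0 g1 : R) : 0 < f0 -> 0 < g0 -> f1 < 0 \/ g1 < 0 ->
  exists2 t, 0 < t < 1 &
    ((1 - t) * f0 + t * f1 = 0 /\ 0 <= (1 - t) * g0 + t * g1) \/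
    ((1 - t) * g0 + t * g1 = 0 /\ 0 <= (1 - t) * f0 + t * f1).
Proof.
have E x0 x1 : 0 < x0 -> x1 < 0 -> exists2 t : R, 0 < t < 1 & (1 - t) * x0 + t * x1 = 0.
  move=> x0p x1n; have D0 : 0 < x0 - x1 by lra.
  exists (x0 / (x0 - x1)); last by field; rewrite gt_eqF.
  by rewrite divr_gt0 //= ltr_pdivrMr // mul1r; lra.
move=> f0p g0p.
have H : forall x0 x1 y0 y1 : R, 0 < x0 -> 0 < y0 -> x1 < 0 ->
  exists2 t, 0 < t < 1 &
    ((1 - t) * x0 + t * x1 = 0 /\ 0 <= (1 - t) * y0 + t * y1) \/
    ((1 - t) * y0 + t * y1 = 0 /\ 0 <= (1 - t) * x0 + t * x1).
  move=> x0 x1 y0 y1 x0p y0p x1n; have [t t01 te] := E _ _ x0p x1n.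
  have [y1p|y1n] := leP 0 y1; first by exists t => //; left; split => //; nra.
  have [s s01 se] := E _ _ y0p y1n.
  have [ts|st] := leP t s; first by exists t => //; left; split => //; nra.
  by exists s => //; right; split => //; nra.
case=> h; first exact: H.
by have [t t01 te] := H _ _ f0 f1 g0p f0p h; exists t => //; case: te; [right|left].
Qed.

End Plane.

(** * Neighbours in a maximal noncrossing set of segments *)

Section Triangulation.
Variables (R : realType) (V : finType) (P : V -> point R).

Local Notation o a b c := (orient (P a) (P b) (P c)).

Definition general_position :=
  forall a b c, a != b -> b != c -> a != c -> o a b c != 0.

Definition vcross (a b c d : V) := cross (P a) (P b) (P c) (P d).

Definition noncrossing (T : {set V * V}) :=
  forall a b c d, (a, b) \in T -> (c, d) \in T -> ~~ vcross a b c d.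

Definition saturated (T : {set V * V}) :=
  forall a b, a != b -> (forall c d, (c, d) \in T -> ~~ vcross a b c d) ->
  (a, b) \in T.

Hypothesis gp : general_position.

Lemma orient_eq0 a b c : o a b c = 0 -> [\/ a = b, b = c | a = c].
Proof.
move=> o0; have [->|ab] := eqVneq a b; first by constructor.
have [->|bc] := eqVneq b c; first by constructor.
have [->|ac] := eqVneq a c; first by constructor.
by have := gp ab bc ac; rewrite o0 eqxx.
Qed.

(** To the left of [u v] the angle at [u] decreases with its cotangent, which is [dot s / o u v s];
    a maximum of the latter is the first point met when turning left. *)
Lemma least_angle (Q : pred V) u v x0 :
    (forall s, Q s -> 0 < o u v s) -> Q x0 ->
  exists2 x, Q x & forall s, Q s -> 0 <= o u x s.
Proof.
move=> Qpos Qx0.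
pose dot s := ((P v).1 - (P u).1) * ((P s).1 - (P u).1) +
              ((P v).2 - (P u).2) * ((P s).2 - (P u).2).
have [x Qx xmax] := @arg_maxP _ _ _ x0 Q (fun s => dot s / o u v s) Qx0.
exists x => // s Qs; have := xmax s Qs; rewrite /= => h.
have {h} : dot s * o u v x <= dot x * o u v s.
  have := h; rewrite ler_pdivrMr ?Qpos // mulrAC ler_pdivlMr ?Qpos //.
pose nn := ((P v).1 - (P u).1) ^+ 2 + ((P v).2 - (P u).2) ^+ 2.
(* The sine of a difference of two angles, up to scaling; [nn] is the squared length of [u v]. *)
have e : o u x s * nn = dot x * o u v s - dot s * o u v x.
  rewrite /nn /dot /orient.
  by case: (P u) (P v) (P x) (P s) => [? ?] [? ?] [? ?] [? ?] /=; ring.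
have nn0 : 0 < nn.
  rewrite lt_neqAle addr_ge0 ?sqr_ge0 // andbT eq_sym.
  rewrite paddr_eq0 ?sqr_ge0 // !sqrf_eq0; apply/negP => /andP[/eqP h1 /eqP h2].
  by have := Qpos _ Qx; rewrite /orient h1 h2 !mul0r subrr ltxx.
by move=> h; rewrite -(pmulr_lge0 _ nn0) e subr_ge0.
Qed.

(** At the common point the orientation with respect to one segment vanishes. It is a convex
    combination of two values at the ends of the other, nonzero by general position, so these have
    opposite signs. *)
Lemma segments_meet_cross a b c d e :
  a != c -> a != d -> b != c -> b != d -> a != b -> c != d ->
  on_seg (P a) (P b) e -> on_seg (P c) (P d) e -> vcross a b c d.
Proof.
move=> ac ad bc bd ab cd.
have E p q r s : p != r -> p != s -> q != r -> q != s -> p != q ->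
    on_seg (P p) (P q) e -> on_seg (P r) (P s) e -> o p q r * o p q s < 0.
  move=> pr ps qr qs pq /on_segP[t tb ->] /on_segP[t' tb' e2].
  have := congr1 (orient (P p) (P q)) e2.
  rewrite !orient_lin orient_xyx orient_xyy !mulr0 addr0 => e3.
  have n1 := gp pq qr pr; have n2 := gp pq qs ps.
  rewrite lt_neqAle mulf_neq0 //=.
  have [t0|t0] := eqVneq t' 0.
    by case/eqP: n1; move: e3; rewrite t0; lra.
  have tp : 0 < t' by rewrite lt_neqAle eq_sym t0; lra.
  by nra.
by move=> h1 h2; apply/andP; split; apply: E => //; rewrite eq_sym.
Qed.

Lemma share_endpoint a b d e : o a b d != 0 ->
  on_seg (P a) (P b) e -> on_seg (P a) (P d) e -> e = P a.
Proof.
move=> n0 /on_segP[t tb ->] /on_segP[t' tb' e2].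
have := congr1 (orient (P a) (P b)) e2.
rewrite !orient_lin orient_xyx orient_xyy !mulr0 !add0r => /esym/eqP.
rewrite mulf_eq0 (negPf n0) orbF => /eqP t0.
by rewrite e2 t0 lin0.
Qed.

Variable T : {set V * V}.
Hypothesis T_irr : forall a b, (a, b) \in T -> a != b.
Hypothesis T_nc : noncrossing T.
Hypothesis T_max : saturated T.

Lemma T_sym a b : (a, b) \in T -> (b, a) \in T.
Proof.
move=> ab; apply: T_max; first by rewrite eq_sym T_irr.
by move=> c d cd; rewrite /vcross cross_swapl T_nc.
Qed.

Lemma T_meet a b c d e : (a, b) \in T -> (c, d) \in T ->
    on_seg (P a) (P b) e -> on_seg (P c) (P d) e ->
  (exists w, [/\ w = a \/ w = b, w = c \/ w = d & e = P w]) \/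
  (a = c /\ b = d \/ a = d /\ b = c).
Proof.
have E a' b' d' : (a', b') \in T -> (a', d') \in T ->
    on_seg (P a') (P b') e -> on_seg (P a') (P d') e -> e = P a' \/ b' = d'.
  move=> h1 h2 h3 h4; have [bd|bd] := eqVneq b' d'; first by right.
  left; apply: share_endpoint h3 h4.
  by apply: gp => //; [exact: T_irr h1|exact: T_irr h2].
move=> ab cd e1 e2; have ba := T_sym ab; have dc := T_sym cd.
have e1' := on_segC e1; have e2' := on_segC e2.
have [?|ac] := eqVneq a c.
  subst c; have [->|->] := E _ _ _ ab cd e1 e2; last by right; left.
  by left; exists a; split => //; left.
have [?|ad] := eqVneq a d.
  subst d; have [->|->] := E _ _ _ ab dc e1 e2'; last by right; right.
  by left; exists a; split => //; [left|right].
have [?|bc] := eqVneq b c.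
  subst c; have [->|->] := E _ _ _ ba cd e1' e2; last by right; right.
  by left; exists b; split => //; [right|left].
have [?|bd] := eqVneq b d.
  subst d; have [->|->] := E _ _ _ ba dc e1' e2'; last by right; left.
  by left; exists b; split => //; right.
have := T_nc ab cd; rewrite (segments_meet_cross _ _ _ _ _ _ e1 e2) //.
- exact: T_irr ab.
- exact: T_irr cd.
Qed.

(** Only a crossing edge can keep [u x] out of a saturated set; as edges are reversible, its first
    end may be taken on the right. *)
Lemma blocking_edge u x : u != x -> (u, x) \notin T ->
  exists c d, [/\ (c, d) \in T, vcross u x c d & o u x c < 0 < o u x d].
Proof.
move=> ux uxT; have : [exists cd in T, vcross u x cd.1 cd.2].
  apply: contraNT uxT; rewrite negb_exists_in => /forall_inP h.
  by apply: T_max => // c d cd; apply: (h (c, d)).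
case/exists_inP=> -[c d] /= cd X.
have [h|h|h] := ltrgtP (o u x c) 0; last by move: X; rewrite /vcross /cross h mul0r ltxx.
  exists c, d; split => //; rewrite h /=; by move: X => /andP[]; nra.
exists d, c; split; [exact: T_sym|by rewrite /vcross cross_swapr|].
by rewrite h andbT; move: X => /andP[]; nra.
Qed.

(** The last clause says that no edge of [T] crosses [u x] strictly before [q p]: if the crossing at
    parameter [t] is not beyond [q p], it lies on the line of [q p]. *)
Lemma nearest_block u x : u != x -> (u, x) \notin T ->
  exists q p, [/\ (q, p) \in T, o u x q < 0 < o u x p, o q p x < 0 < o q p u &
    forall c d t, (c, d) \in T -> vcross u x c d ->
      (1 - t) * o c d u + t * o c d x = 0 ->
      0 <= (1 - t) * o q p u + t * o q p x -> (1 - t) * o q p u + t * o q p x = 0].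
Proof.
move=> ux uxT; have [c0 [d0 [cd0 X0 s0]]] := blocking_edge ux uxT.
pose Q (e : V * V) := [&& e \in T, vcross u x e.1 e.2 & o u x e.1 < 0 < o u x e.2].
(* The parameter along [u x] at which the edge crosses it. *)
pose key (e : V * V) := o e.1 e.2 u / (o e.1 e.2 u - o e.1 e.2 x).
have Q0 : Q (c0, d0) by apply/and3P.
have [[q p] /and3P[/= qp X s] kmin] := @arg_minP _ _ _ (c0, d0) Q key Q0.
have sgn c d : vcross u x c d -> o u x c < 0 < o u x d -> o c d x < 0 < o c d u.
  move=> /andP[_ h] h'; have := orient_diff (P u) (P x) (P d) (P c).
  rewrite ![orient (P d) (P c) _]orient_swap => e.
  by apply/andP; nra.
have sqp := sgn _ _ X s.
exists q, p; split => // c d t cd Xcd te tz.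
have kE c' d' : (c', d') \in T -> vcross u x c' d' -> o u x c' < 0 < o u x d' ->
    (1 - t) * o c' d' u + t * o c' d' x = 0 ->
    (1 - t) * o q p u + t * o q p x = 0.
  move=> cd' X' s' te'; have sc := sgn _ _ X' s'.
  have /kmin : Q (c', d') by apply/and3P.
  rewrite /key /= => h.
  have D1 : 0 < o c' d' u - o c' d' x by lra.
  have D2 : 0 < o q p u - o q p x by lra.
  have et : o c' d' u / (o c' d' u - o c' d' x) = t.
    by rewrite -[RHS](mulfK (lt0r_neq0 D1)); congr (_ / _); lra.
  by move: h; rewrite et ler_pdivrMr // => h; lra.
have [h|h|h] := ltrgtP (o u x c) 0.
- by apply: (kE c d) => //; rewrite h /=; move: Xcd => /andP[]; nra.
- apply: (kE d c) => //; first exact: T_sym.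
  + by rewrite /vcross cross_swapr.
  + by rewrite h andbT; move: Xcd => /andP[]; nra.
  + by rewrite ![orient (P d) (P c) _]orient_swap; lra.
- by move: Xcd; rewrite /vcross /cross h mul0r ltxx.
Qed.

(* Let [x] be the first point met when turning left from [u v] around [u]. If
   [u x] is blocked, let [q p] be the blocking edge nearest to [u], at [z]. Among
   the points of the triangle [u z p] let [y] be the first one met when turning
   from [u x]; an edge blocking [u y] would have to leave the triangle through
   [u z] or [z p]. *)
Lemma neighbour_in_halfplane u v s0 : 0 < o u v s0 ->
  exists2 y, (u, y) \in T & 0 < o u v y.
Proof.
move=> s0pos.
have [x xpos xmin] := @least_angle (fun s => 0 < o u v s) u v s0 (fun _ => id) s0pos.
have ux : u != x by apply: contraTneq xpos => <-; rewrite orient_xyx ltxx.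
have [uxT|uxT] := boolP ((u, x) \in T); first by exists x.
have [q [p [qp /andP[xq xp] /andP[zx zu] near]]] := nearest_block ux uxT.
have vq : o u v q <= 0 by rewrite leNgt; apply/negP => /xmin; lra.
have qpE : o u q p = o q p u by rewrite -orient_cyc.
have vp : 0 < o u v p.
  have := plucker (P u) (P v) (P x) (P q) (P p); rewrite qpE => h.
  by nra.
(* The triangle [u z p] without the points on its side along [u x]. *)
pose C s := [&& 0 < o u x s, 0 <= o q p s & 0 <= o u s p].
have Cp : C p by rewrite /C xp orient_xyy orient_xyy lexx.
have [y /and3P[xy zy yp] ymin] :=
  @least_angle C u x p (fun s h => let: And3 h _ _ := and3P h in h) Cp.
have vy : 0 < o u v y.
  have := plucker (P u) (P v) (P x) (P y) (P p) => h.
  by nra.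
exists y => //.
have uy : u != y by apply: contraTneq vy => <-; rewrite orient_xyx ltxx.
apply: contraT => uyT; suff: False by [].
have [c [d [cd X /andP[yc yd]]]] := blocking_edge uy uyT.
have [r [s [r01 s01 ke]]] := cross_point X.
have cu : c != u by apply: contraTneq yc => ->; rewrite orient_xyx ltxx.
have du : d != u by apply: contraTneq yd => ->; rewrite orient_xyx ltxx.
set k := lin s _ _ in ke.
have xk : 0 < orient (P u) (P x) k.
  by rewrite ke orient_lin orient_xyx; nra.
have zk : 0 < orient (P q) (P p) k by rewrite ke orient_lin; nra.
have yk : orient (P u) (P y) k = 0 by rewrite ke orient_lin orient_xyx orient_xyy; lra.
(* Inside the triangle, [c] would be met before [y], since it lies to the right of [u y]. *)
have cout : o u x c < 0 \/ o q p c < 0.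
  have [xc|xc|/orient_eq0[]] := ltrgtP (o u x c) 0; first by left.
  - have [zc|zc] := ltP (o q p c) 0; first by right.
    have cp : 0 <= o u c p.
      have := plucker (P u) (P x) (P y) (P c) (P p) => h.
      by nra.
    have /ymin : C c by apply/and3P.
    by lra.
  - by move/eqP; rewrite (negPf ux).
  - by move=> <-; right.
  - by move/esym/eqP; rewrite (negPf cu).
(* [e] is the point where the way from the crossing point [k] to [c] leaves the triangle. *)
have [t t01] := first_exit xk zk cout.
rewrite -!orient_lin; set e := lin t k (P c).
have ecd : on_seg (P c) (P d) e.
  apply/on_segP; exists ((1 - t) * s); first by nra.
  by rewrite /e /k /lin /=; congr pair; ring.
have ye : orient (P u) (P y) e < 0 by rewrite /e orient_lin yk; nra.
(* Such an [e] is strictly inside the edge [q p], where no other edge passes; and [c d] is not this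
   edge, because [k] is off its line. *)
have case2 : orient (P q) (P p) e = 0 -> 0 <= orient (P u) (P x) e -> False.
  move=> ze xe.
  have qnp : P q <> P p by move=> qp'; move: zu; rewrite qp' orient_xxy ltxx.
  have [m em] := orient0_lin qnp ze.
  have pe : 0 < orient (P u) e (P p).
    have := plucker (P u) (P x) (P y) e (P p) => h.
    by nra.
  have m1 : m < 1.
    move: pe; rewrite -orient_cyc em -orient_cyc orient_lin.
    rewrite orient_xyx mulr0 addr0 orient_cyc => h.
    have : o p u q = o q p u by rewrite orient_cyc.
    by rewrite orient_cyc in h *; nra.
  have m0 : 0 < m by move: xe; rewrite em orient_lin; nra.
  have eqp : on_seg (P q) (P p) e by apply/on_segP; exists m => //; lra.
  have [[w [[->|->] _ ew]]|[[qc pd]|[qd pc]]] := T_meet qp cd eqp ecd.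
  - by move: xe; rewrite ew; lra.
  - by move: pe; rewrite ew orient_xyy ltxx.
  - by move: zk; rewrite /k orient_lin qc pd orient_xyx orient_xyy; lra.
  - by move: zk; rewrite /k orient_lin qd pc orient_xyx orient_xyy; lra.
case=> [[xe ze]|[ze xe]]; last exact: case2 ze xe.
have unx : P u <> P x by move=> ux'; move: xp; rewrite ux' orient_xxy ltxx.
have [m em] := orient0_lin unx xe.
have m0 : 0 < m.
  move: ye; rewrite em orient_lin orient_xyx.
  have := orient_swapr (P u) (P x) (P y).
  by nra.
have m1 : m < 1 by move: ze; rewrite em orient_lin; nra.
have eux : on_seg (P u) (P x) e by apply/on_segP; exists m => //; lra.
have enx a b : (a, b) \in T -> on_seg (P a) (P b) e -> b != u -> a != x.
  move=> ab eab bu; apply/eqP => ax; rewrite ax in ab eab.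
  have n0 : o x b u != 0 by by apply: gp => //; [exact: T_irr ab|rewrite eq_sym].
  have ex := share_endpoint n0 eab (on_segC eux).
  by move: ze; rewrite ex; lra.
have cx : c != x by apply: enx cd ecd du.
have dx : d != x by apply: enx (T_sym cd) (on_segC ecd) cu.
(* Leaving through [u x], the edge [c d] itself blocks [u x], and not beyond [q p]. As [q p] is
   nearest, [e] lies on it, which is the case already excluded. *)
have Xe : vcross u x c d.
  by apply: segments_meet_cross eux ecd => //;
    first [exact: T_irr cd | by rewrite eq_sym].
apply: case2; last by rewrite xe.
move: ze; rewrite em orient_lin => /(near _ _ _ cd Xe); apply.
rewrite -orient_lin -em; have /on_segP[m' _ ->] := ecd.
by rewrite orient_lin orient_xyx orient_xyy; ring.
Qed.

End Triangulation.

(** * Empty triangles on the left of an edge *)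

Section Triangles.
Variables (R : realType) (V : finType) (P : V -> point R) (T : {set V * V}).
Hypothesis gp : general_position P.
Hypothesis T_irr : forall a b, (a, b) \in T -> a != b.
Hypothesis T_nc : noncrossing P T.
Hypothesis T_max : saturated P T.

Local Notation o a b c := (orient (P a) (P b) (P c)).
Let Tsym := T_sym T_irr T_nc T_max.

Definition empty_triangle u v w :=
  [/\ 0 < o u v w, (u, v) \in T, (v, w) \in T, (w, u) \in T &
    forall s, ~ [/\ 0 < o u v s, 0 < o v w s & 0 < o w u s]].

Lemma empty_triangle_cyc u v w : empty_triangle u v w -> empty_triangle v w u.
Proof.
move=> [h1 h2 h3 h4 h5]; split => //; first by rewrite orient_cyc.
by move=> s [s1 s2 s3]; apply: (h5 s).
Qed.

(* An edge through a point [k] of the triangle [u v w] cannot leave it through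
   the edges [u v] and [u w], so its part on the side of [u] stays inside. *)
Lemma wedge_exit u v w c d k s : (u, v) \in T -> (u, w) \in T -> 0 < o u v w ->
    (c, d) \in T -> c != u -> d != u -> 0 < s < 1 -> k = lin s (P c) (P d) ->
    0 <= orient (P v) (P w) k -> 0 < orient (P w) (P u) k ->
    0 < orient (P u) (P v) k -> 0 < o v w c ->
  ~ (o u v c < 0 \/ o w u c < 0).
Proof.
move=> uv uw D0 cd cu du s01 ke ka kb kc ca cout.
have [t t01] := first_exit kc kb cout; rewrite -!orient_lin.
set e := lin t k (P c).
have ecd : on_seg (P c) (P d) e.
  apply/on_segP; exists ((1 - t) * s); first by nra.
  by rewrite /e ke /lin /=; congr pair; ring.
have ea : 0 < orient (P v) (P w) e.
  by rewrite /e orient_lin; nra.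
have vwu : 0 < o v w u by rewrite orient_cyc.
have wuv : 0 < o w u v by rewrite -orient_cyc.
have stop x : x = v \/ x = w -> (u, x) \in T -> on_seg (P u) (P x) e -> False.
  move=> xvw ux eux.
  have [[z [[->|->] zcd ez]]|[[uc _]|[ud _]]] :=
    T_meet gp T_irr T_nc T_max ux cd eux ecd.
  - by case: zcd => zE; [move: cu|move: du]; rewrite zE eqxx.
  - by move: ea; rewrite ez; case: xvw => ->; rewrite ?orient_xyx ?orient_xyy ltxx.
  - by move: cu; rewrite uc eqxx.
  - by move: du; rewrite ud eqxx.
case=> [[e0 e1]|[e0 e1]].
- have uv' : P u <> P v by move=> h; move: D0; rewrite h orient_xxy ltxx.
  have [m em] := orient0_lin uv' e0.
  apply: (stop v) => //; first by left.
  apply/on_segP; exists m => //; move: ea e1; rewrite em !orient_lin.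
  rewrite !orient_xyx orient_xyy; nra.
- have uw' : P u <> P w by move=> h; move: D0; rewrite h orient_xyx ltxx.
  have wu' : P w <> P u by move=> h; apply: uw'.
  have [m em] := orient0_lin wu' e0.
  apply: (stop w) => //; first by right.
  apply/on_segC/on_segP; exists m => //; move: ea e1; rewrite em !orient_lin.
  rewrite !orient_xyx !orient_xyy; nra.
Qed.

(* The third vertex is the first neighbour of [u] when turning left from [u v].
   The triangle is empty, since an inner point farthest from [v w] would be a
   neighbour of [u]. *)
Lemma triangle_on_left u v s0 : (u, v) \in T -> 0 < o u v s0 ->
  exists w, empty_triangle u v w.
Proof.
move=> uvT s0pos.
have [y0 y0T y0pos] := neighbour_in_halfplane gp T_irr T_nc T_max s0pos.
pose Q s := (0 < o u v s) && ((u, s) \in T).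
have Qy0 : Q y0 by apply/andP.
have [w /andP[uvw uwT] wmin] :=
  @least_angle _ _ P Q u v y0 (fun s h => proj1 (andP h)) Qy0.
have vwu : 0 < o v w u by rewrite orient_cyc.
have wuv : 0 < o w u v by rewrite -orient_cyc.
have no_spoke s : (u, s) \in T -> 0 < o u v s -> 0 < o w u s -> False.
  move=> us s1 s2; have /wmin : Q s by apply/andP.
  by rewrite orient_swap; lra.
have uw : u != w := T_irr uwT; have uv : u != v := T_irr uvT.
have vw : v != w by apply: contraTneq uvw => ->; rewrite orient_xyy ltxx.
have outside c : c != u -> 0 < o v w c ->
    ~ [/\ 0 < o u v c, 0 < o v w c & 0 < o w u c] -> o u v c < 0 \/ o w u c < 0.
  move=> cu ca cout.
  have [h1|h1|/(orient_eq0 gp)[]] := ltrgtP (o u v c) 0; first by left.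
  - have [h2|h2|/(orient_eq0 gp)[]] := ltrgtP (o w u c) 0; first by right.
    + by case: cout.
    + by move/eqP; rewrite eq_sym (negPf uw).
    + by move/esym/eqP; rewrite (negPf cu).
    + by move=> h; move: ca; rewrite -h orient_xyy ltxx.
  - by move/eqP; rewrite (negPf uv).
  - by move=> h; move: ca; rewrite -h orient_xyx ltxx.
  - by move/esym/eqP; rewrite (negPf cu).
have emp s : ~ [/\ 0 < o u v s, 0 < o v w s & 0 < o w u s].
  move=> [s1 s2 s3].
  pose I s := [&& 0 < o u v s, 0 < o v w s & 0 < o w u s].
  have Is : I s by apply/and3P.
  have [x /and3P[x1 x2 x3] xmax] := @arg_maxP _ _ _ s I (fun s => o v w s) Is.
  have ux : u != x by apply: contraTneq x1 => <-; rewrite orient_xyx ltxx.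
  have [uxT|uxT] := boolP ((u, x) \in T); first exact: no_spoke uxT x1 x3.
  have [c0 [d0 [cd0 X0 _]]] := blocking_edge T_irr T_nc T_max ux uxT.
  (* [c] is the end farther from [v w]. The crossing point, between [u] and [x], is already farther
     than [x], hence so is [c], which is therefore outside the triangle. *)
  have [c [d [cd X cd_le]]] : exists c d,
      [/\ (c, d) \in T, vcross P u x c d & o v w d <= o v w c].
    have [h|h] := leP (o v w d0) (o v w c0); first by exists c0, d0.
    exists d0, c0; split; [exact: Tsym|by rewrite /vcross cross_swapr|exact: ltW].
  have [r [t [r01 t01 ke]]] := cross_point X.
  have cu : c != u.
    by apply: contraTneq X => ->; rewrite /vcross /cross orient_xyx mul0r ltxx.
  have du : d != u.
    apply: contraTneq X => ->.
    by rewrite /vcross /cross orient_xyx mulr0 ltxx.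
  have xc : o v w x < o v w c.
    have := orient_split (P v) (P w) (P u) (P x).
    have := congr1 (orient (P v) (P w)) ke; rewrite !orient_lin.
    nra.
  have ca : 0 < o v w c by lra.
  have cI : ~ [/\ 0 < o u v c, 0 < o v w c & 0 < o w u c].
    move=> [c1 c2 c3]; have /xmax /= : I c by apply/and3P.
    lra.
  apply: (wedge_exit uvT uwT uvw cd cu du t01 erefl) (outside c cu ca cI) => //;
    by rewrite ke orient_lin ?orient_xyx ?orient_xyy; nra.
(* An edge blocking [v w] has an end [c] on the side of [u]. If [c] is [u], the edge is a spoke
   between [u v] and [u w]; otherwise, the triangle being empty, it must leave through [u v] or
   [u w]. *)
have vwT : (v, w) \in T.
  apply: contraT => vwT; suff: False by [].
  have [d [c [dc X /andP[dn cp]]]] := blocking_edge T_irr T_nc T_max vw vwT.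
  have cd := Tsym dc.
  have X' : vcross P v w c d by rewrite /vcross cross_swapr.
  have [r [t [r01 t01 ke]]] := cross_point X'.
  have du : d != u by apply: contraTneq dn => ->; rewrite -leNgt ltW.
  have k2 : 0 < orient (P u) (P v) (lin t (P c) (P d)).
    by rewrite ke orient_lin orient_xyy; nra.
  have k3 : 0 < orient (P w) (P u) (lin t (P c) (P d)).
    by rewrite ke orient_lin orient_xyx; nra.
  have cu : c != u.
    apply: contraT => /negPn/eqP E; suff: False by [].
    apply: (no_spoke d); first by rewrite -E.
    - by move: k2; rewrite E orient_lin orient_xyx; nra.
    - by move: k3; rewrite E orient_lin orient_xyy; nra.
  apply: (wedge_exit uvT uwT uvw cd cu du t01 erefl) (outside c cu cp (emp c)) => //.
  by rewrite ke orient_lin orient_xyx orient_xyy; lra.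
by exists w; split => //; exact: Tsym.
Qed.

End Triangles.

Lemma exists_notin_pair (V : finType) (a b : V) : (2 < #|V|)%N ->
  exists s, (s != a) && (s != b).
Proof.
move=> V3; have : (0 < #|~: [set a; b]|)%N.
  rewrite cardsCs setCK subn_gt0; apply: leq_ltn_trans V3.
  by rewrite cards2; case: (a != b).
by case/card_gt0P=> s; rewrite !inE negb_or; exists s.
Qed.

(** Choice turns a total injective relation into an injection, so that counting requires no explicit
    map from edges to triangles. *)
Lemma card_le_of_rel (A B : finType) (E : {set A}) (K : {set B})
    (rho : A -> B -> Prop) :
    (forall x, x \in E -> exists2 k, k \in K & rho x k) ->
    (forall x y k, x \in E -> y \in E -> rho x k -> rho y k -> x = y) ->
  (#|E| <= #|K|)%N.
Proof.
move=> tot inj.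
have /fin_all_exists[f fP] (x : {x | x \in E}) : exists k, k \in K /\ rho (val x) k.
  by have [k kK r] := tot _ (valP x); exists k.
have f_inj : injective f.
  move=> x y fxy; apply: val_inj; apply: (inj _ _ (f x)); try exact: valP.
    by have [] := fP x.
  by rewrite fxy; have [] := fP y.
rewrite -(card_sig (mem E)) -(card_imset predT f_inj); apply: subset_leq_card.
by apply/subsetP => k /imsetP[x _ ->]; have [] := fP x.
Qed.

(** * Counting empty triangles by their middle vertices *)

Section Sweep.
Variables (R : realType) (V : finType) (P : V -> point R) (T : {set V * V}).
Hypothesis gp : general_position P.
Hypothesis x_inj : injective (fun v => (P v).1).
Hypothesis T_irr : forall a b, (a, b) \in T -> a != b.
Hypothesis T_nc : noncrossing P T.
Hypothesis T_max : saturated P T.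

Local Notation o a b c := (orient (P a) (P b) (P c)).
Local Notation empty_triangle := (empty_triangle P T).

(** An edge entering the triangle at [m] either ends inside, against emptiness, or crosses the
    opposite edge [c a]. *)
Lemma no_inner_spoke a m c x : empty_triangle a m c -> (m, x) \in T ->
  0 < o m c x -> 0 < o m x a -> False.
Proof.
move=> [D0 am mc ca emp] mx h1 h2.
have amx : 0 < o a m x by rewrite -orient_cyc.
have [h|h|/(orient_eq0 gp)[E|E|E]] := ltrgtP (o c a x) 0.
- have := T_nc ca mx; rewrite /vcross /cross.
  have cam : 0 < o c a m by rewrite -orient_cyc.
  have mxc : o m x c < 0 by rewrite orient_swapr oppr_lt0.
  by rewrite pmulr_rlt0 // h nmulr_rlt0 // h2.
- exact: (emp x).
- by move: D0; rewrite E orient_xyx ltxx.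
- by move: h2; rewrite E orient_xyy ltxx.
- by move: h1; rewrite E orient_xyy ltxx.
Qed.

(** Reversing the order of abscissas exchanges up and down for counterclockwise triangles, so one
    sign covers both vertical directions. *)
Definition xs (b : bool) v : R := (-1) ^+ b * (P v).1.

Lemma xs_order (b : bool) p q :
  (xs b p < xs b q) = if b then (P q).1 < (P p).1 else (P p).1 < (P q).1.
Proof. by rewrite /xs; case: b; rewrite ?expr0 ?expr1 ?mul1r ?mulN1r ?ltrN2. Qed.

(* The vertical ray from the middle vertex [m], upwards if [b = false] and
   downwards otherwise, starts inside the triangle. *)
Definition middle m b a c :=
  empty_triangle a m c /\ (xs b a < xs b m < xs b c).

(** Near [m] both triangles contain the same vertical ray. If their sides at [m] differed, a side of
    one would enter the other. *)
Lemma middle_inj m b a c a' c' : middle m b a c -> middle m b a' c' ->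
  a = a' /\ c = c'.
Proof.
have Ha p q p' q' : middle m b p q -> middle m b p' q' -> 0 < o m p' p -> False.
  move=> [t1 /andP[s1 s2]] [t2 /andP[s3 s4]] h.
  apply: (no_inner_spoke t1 (x := p')) => //.
    by case: t2 => _ + _ _ _; exact: (T_sym T_irr T_nc T_max).
  have D0 : 0 < o m q p by case: t1 => D0 _ _ _ _; rewrite orient_cyc.
  (* The Plücker relation at [m] with the fourth point at infinity in the vertical direction. *)
  have e : (xs b m - xs b p) * o m q p' =
    (xs b m - xs b p') * o m q p + (xs b q - xs b m) * o m p' p.
    rewrite /xs /orient; case: (P m) (P p) (P q) (P p') => [? ?] [? ?] [? ?] [? ?] /=.
    by ring.
  have m0 : 0 < xs b m - xs b p by rewrite subr_gt0.
  rewrite -(pmulr_rgt0 _ m0) e addr_gt0 // mulr_gt0 // subr_gt0 //.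
have Hc p q p' q' : middle m b p q -> middle m b p' q' -> 0 < o m q q' -> False.
  move=> [t1 /andP[s1 s2]] [t2 /andP[s3 s4]] h.
  apply: (no_inner_spoke t1 (x := q')) => //.
    by case: t2.
  have D0 : 0 < o m q p by case: t1 => D0 _ _ _ _; rewrite orient_cyc.
  have e : (xs b q - xs b m) * o m q' p =
    (xs b q' - xs b m) * o m q p + (xs b m - xs b p) * o m q q'.
    rewrite /xs /orient; case: (P m) (P p) (P q) (P q') => [? ?] [? ?] [? ?] [? ?] /=.
    by ring.
  have m0 : 0 < xs b q - xs b m by rewrite subr_gt0.
  rewrite -(pmulr_rgt0 _ m0) e addr_gt0 // mulr_gt0 // subr_gt0 //.
move=> h h'.
have neq p q : xs b p < xs b q -> p <> q by move=> + E; rewrite E ltxx.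
have [_ /andP[s1 s2]] := h; have [_ /andP[s3 s4]] := h'.
split.
- have [k|k|/(orient_eq0 gp)[E|E|E]] := ltrgtP (o m a a') 0 => //.
  + by case: (Ha _ _ _ _ h h'); rewrite orient_swapr oppr_gt0.
  + by case: (Ha _ _ _ _ h' h).
  + by case: (neq _ _ s1).
  + by case: (neq _ _ s3).
- have [k|k|/(orient_eq0 gp)[E|E|E]] := ltrgtP (o m c c') 0 => //.
  + by case: (Hc _ _ _ _ h' h); rewrite orient_swapr oppr_gt0.
  + by case: (Hc _ _ _ _ h h').
  + by case: (neq _ _ s2).
  + by case: (neq _ _ s4).
Qed.

(** Of the eight outcomes of the three comparisons of abscissas, two are cyclic and impossible; each
    of the others fixes a rotation of the triangle and a value of [b]. *)
Lemma triangle_middle u v w : empty_triangle u v w ->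
  exists m b a c, middle m b a c /\
    [\/ (u, v) = (a, m), (u, v) = (m, c) | (u, v) = (c, a)].
Proof.
move=> t; have t1 := empty_triangle_cyc t; have t2 := empty_triangle_cyc t1.
have [_ uv vw wu _] := t.
have lt_x p q : (p, q) \in T -> (P p).1 < (P q).1 \/ (P q).1 < (P p).1.
  move=> pq; have [h|h|/x_inj h] := ltrgtP (P p).1 (P q).1; [by left|by right|].
  by have := T_irr pq; rewrite h eqxx.
match goal with |- ?goal => pose G := goal end; change G.
have K a m c b : empty_triangle a m c ->
    [\/ (u, v) = (a, m), (u, v) = (m, c) | (u, v) = (c, a)] ->
    xs b a < xs b m -> xs b m < xs b c -> G.
  by move=> tr E s1 s2; exists m, b, a, c; do !split => //; apply/andP.
have K1 b : xs b u < xs b v -> xs b v < xs b w -> G by apply: K t _; constructor 1.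
have K2 b : xs b v < xs b w -> xs b w < xs b u -> G by apply: K t1 _; constructor 3.
have K3 b : xs b w < xs b u -> xs b u < xs b v -> G by apply: K t2 _; constructor 2.
have := (K1 false, K1 true, K2 false, K2 true, K3 false, K3 true).
rewrite !xs_order /= => -[[[[[L1 L2] L3] L4] L5] L6].
case: (lt_x _ _ uv) (lt_x _ _ vw) (lt_x _ _ wu) => [h1|h1] [h2|h2] [h3|h3].
- by have := lt_trans (lt_trans h1 h2) h3; rewrite ltxx.
- exact: L1.
- exact: L5.
- exact: L4.
- exact: L3.
- exact: L6.
- exact: L2.
- by have := lt_trans (lt_trans h1 h3) h2; rewrite ltxx.
Qed.

Lemma forbidden_slots : (2 < #|V|)%N ->
  exists2 I : {set V * bool}, #|I| = 5%N &
    forall m b a c, middle m b a c -> (m, b) \notin I.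
Proof.
move=> V3; have [v0 _] : exists v0 : V, v0 \in V by apply/card_gt0P; apply: leq_trans V3.
have [L _ Lmin] := @arg_minP _ _ _ v0 predT (fun v => (P v).1) isT.
have [M _ Mmax] := @arg_maxP _ _ _ v0 predT (fun v => (P v).1) isT.
have [s /andP[sL sM]] := exists_notin_pair L M V3.
have LM : (P L).1 < (P M).1.
  rewrite lt_neqAle (Lmin M) // andbT; apply/eqP => /x_inj E.
  have := Lmin s isT; have := Mmax s isT; rewrite /= -E => h1 h2.
  by case/eqP: sL; apply: x_inj; apply/eqP; rewrite eq_le h1 h2.
have LnM : L != M by apply: contraTneq LM => ->; rewrite ltxx.
have o0 : o L M s != 0 by apply: gp; rewrite // eq_sym.
(* [b0] selects a side of the line [L M] that contains a point, and [f] is positive on that side. *)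
pose b0 := o L M s < 0; pose f v := (-1) ^+ b0 * o L M v.
have fs : 0 < f s.
  rewrite /f /b0; have [h|h] := ltP (o L M s) 0; first by rewrite expr1 mulN1r oppr_gt0.
  by rewrite expr0 mul1r lt_neqAle eq_sym o0.
have [v _ vmax] := @arg_maxP _ _ _ s predT f isT.
have fv : 0 < f v by apply: lt_le_trans fs (vmax s isT).
have vL : v != L by apply: contraTneq fv => ->; rewrite /f orient_xyx mulr0 ltxx.
have vM : v != M by apply: contraTneq fv => ->; rewrite /f orient_xyy mulr0 ltxx.
exists [set x in [:: (L, true); (L, false); (M, true); (M, false); (v, b0)]].
  rewrite cardsE; apply/card_uniqP => /=.
  by rewrite !inE !xpair_eqE !eqxx /= ![_ == v]eq_sym (negPf vL) (negPf vM) (negPf LnM).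
move=> m b a c [[D0 _ _ _ _] /andP[am mc]]; rewrite inE; apply/negP.
have nL : m != L.
  apply/eqP => E; subst m; move: am mc; rewrite !xs_order.
  have := Lmin a isT; have := Lmin c isT.
  by case: b => /= h1 h2 h3 h4; lra.
have nM : m != M.
  apply/eqP => E; subst m; move: am mc; rewrite !xs_order.
  have := Mmax a isT; have := Mmax c isT.
  by case: b => /= h1 h2 h3 h4; lra.
rewrite !inE !xpair_eqE (negPf nL) (negPf nM) /= => /andP[/eqP mv /eqP bb].
rewrite mv in D0 am mc; rewrite bb in am mc.
(* The triangle would put [v] strictly closer to the line [L M] than the point of the chord [a c] at
   the same abscissa, while [f] is maximal at [v]. *)
have e : f v * (xs b0 c - xs b0 a) =
    f a * (xs b0 c - xs b0 v) + f c * (xs b0 v - xs b0 a)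
    - ((P M).1 - (P L).1) * o a v c.
  rewrite /f /xs /orient.
  case: (P L) (P M) (P a) (P v) (P c) => [? ?] [? ?] [? ?] [? ?] [? ?] /=.
  by case: (b0); rewrite ?expr0 ?expr1; ring.
have h1 := vmax a isT; have h2 := vmax c isT; rewrite /= in h1 h2.
have h3 : 0 < ((P M).1 - (P L).1) * o a v c by rewrite mulr_gt0 // subr_gt0.
have h4 : f a * (xs b0 c - xs b0 v) <= f v * (xs b0 c - xs b0 v).
  by rewrite ler_wpM2r // subr_ge0 ltW.
have h5 : f c * (xs b0 v - xs b0 a) <= f v * (xs b0 v - xs b0 a).
  by rewrite ler_wpM2r // subr_ge0 ltW.
by lra.
Qed.

(** Edges with the same slot bound the same triangle. Any two edges of an oriented triangle are
    consecutive, so they cannot both lead from [col] to its complement. *)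
Lemma directed_edges_bound (col : pred V) (E : {set V * V}) : (2 < #|V|)%N ->
    (forall u v, (u, v) \in E ->
      [/\ (u, v) \in T, col u, ~~ col v & exists s, 0 < o u v s]) ->
  (#|E| + 5 <= #|V| * 2)%N.
Proof.
move=> V3 EP; have [I I5 IP] := forbidden_slots V3.
rewrite -I5 -[2%N]card_bool -card_prod -(cardsC I) addnC leq_add2l.
apply: (@card_le_of_rel _ _ _ _ (fun e k => exists a c, middle k.1 k.2 a c /\
    [\/ e = (a, k.1), e = (k.1, c) | e = (c, a)])).
- move=> [u v] /EP[uv _ _ [s s0]].
  have [w t] := triangle_on_left gp T_irr T_nc T_max uv s0.
  have [m [b [a [c [mid e]]]]] := triangle_middle t.
  exists (m, b); last by exists a, c.
  by rewrite inE (IP _ _ _ _ mid).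
- move=> [u v] [u' v'] [m b] /EP[_ cu cv _] /EP[_ cu' cv' _] /=.
  move=> [a [c [mid e]]] [a' [c' [mid' e']]].
  have [? ?] := middle_inj mid mid'; subst a' c'.
  case: e => -[? ?]; case: e' => -[? ?]; subst => //.
  + by rewrite cu' in cv.
  + by rewrite cu in cv'.
  + by rewrite cu in cv'.
  + by rewrite cu' in cv.
  + by rewrite cu' in cv.
  + by rewrite cu in cv'.
Qed.

End Sweep.

(** * Perturbation into general position *)

Section Perturbation.
Variable R : realType.
Implicit Types (a b c d e p q : point R) (Q : R -> Prop).

Definition near0 Q := exists2 del : R, 0 < del & forall t, 0 < t < del -> Q t.

Lemma near0_true Q : (forall t, Q t) -> near0 Q.
Proof. by move=> h; exists 1. Qed.

Lemma near0_and Q1 Q2 : near0 Q1 -> near0 Q2 -> near0 (fun t => Q1 t /\ Q2 t).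
Proof.
move=> [d1 d1p h1] [d2 d2p h2]; exists (Num.min d1 d2); first by rewrite lt_min d1p.
by move=> t; rewrite lt_min => /and3P[t0 t1 t2]; split; [apply: h1|apply: h2]; apply/andP.
Qed.

Lemma near0_sub Q1 Q2 : (forall t, 0 < t -> Q1 t -> Q2 t) -> near0 Q1 -> near0 Q2.
Proof. by move=> h [d dp h1]; exists d => // t /andP[t0 t1]; apply/h/h1/andP. Qed.

Lemma near0_all (I : finType) (Q : I -> R -> Prop) :
  (forall i, near0 (Q i)) -> near0 (fun t => forall i, Q i t).
Proof.
move=> h; have H (s : seq I) : near0 (fun t => forall i, i \in s -> Q i t).
  elim: s => [|i s IH]; first exact: near0_true.
  apply: near0_sub (near0_and (h i) IH) => t _ [h1 h2] j.
  by rewrite inE => /predU1P[->//|]; exact: h2.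
by apply: near0_sub (H (enum I)) => t _ h1 i; apply: h1; rewrite mem_enum.
Qed.

Lemma near0_gt0 (x y z : R) : 0 < x -> near0 (fun t => 0 < x + t * y + t ^+ 2 * z).
Proof.
move=> x0; have n0 : 0 < `|y| + `|z| + 1 by rewrite ltr_wpDl // addr_ge0.
(* For [t < 1] the square is below [t], so the two higher terms amount to at most [t * (|y| + |z|)];
   adding 1 keeps the denominator positive. *)
exists (Num.min 1 (x / (`|y| + `|z| + 1))); first by rewrite lt_min ltr01 divr_gt0.
move=> t; rewrite lt_min ltr_pdivlMr // => /and3P[t0 t1 tx].
have hy : - (t * `|y|) <= t * y by rewrite -mulrN ler_pM2l // lerNl ler_normr lexx orbT.
have hz : - (t ^+ 2 * `|z|) <= t ^+ 2 * z.
  by rewrite -mulrN ler_pM2l ?exprn_gt0 // lerNl ler_normr lexx orbT.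
have ht : t ^+ 2 * `|z| <= t * `|z|.
  by rewrite ler_wpM2r // expr2 ger_pMr // ltW.
by nra.
Qed.

(** The nonzero coefficient of least degree dominates. *)
Lemma near0_quadratic (x y z : R) : [|| x != 0, y != 0 | z != 0] ->
  near0 (fun t => x + t * y + t ^+ 2 * z != 0).
Proof.
have H (x' y' z' : R) : x' != 0 -> near0 (fun t => x' + t * y' + t ^+ 2 * z' != 0).
  case: (ltrgtP x' 0) => // x0 _.
    have x0' : 0 < - x' by rewrite oppr_gt0.
    apply: near0_sub (near0_gt0 (- y') (- z') x0') => t _ h.
    by rewrite -oppr_eq0 !opprD -!mulrN gt_eqF.
  by apply: near0_sub (near0_gt0 y' z' x0) => t _ h; rewrite gt_eqF.
have [->|x0 _] := eqVneq x 0; last exact: H.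
have [->|y0 _] := eqVneq y 0 => /= [z0|].
  apply: near0_sub (near0_true (fun _ => I)) => t t0 _.
  by rewrite mulr0 !add0r mulf_neq0 // expf_neq0 // gt_eqF.
apply: near0_sub (H _ z 0 y0) => t t0 h.
have -> : 0 + t * y + t ^+ 2 * z = t * (y + t * z + t ^+ 2 * 0) by ring.
by rewrite mulf_neq0 // gt_eqF.
Qed.

(** Strict separation by a linear functional is an open condition on the four points, so it survives
    a small perturbation. *)
Definition separated a b c d := exists x y : R,
  let f p := x * p.1 + y * p.2 in [/\ f a < f c, f a < f d, f b < f c & f b < f d].

Lemma separatedC a b c d : separated a b c d -> separated c d a b.
Proof. by move=> [x [y [/= h1 h2 h3 h4]]]; exists (- x), (- y); split => /=; lra. Qed.

Lemma separated_side a b c d : 0 < orient a b c * orient a b d -> separated a b c d.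
Proof.
rewrite /orient => h.
have [h1|h1] : (0 < orient a b c /\ 0 < orient a b d) \/
    (orient a b c < 0 /\ orient a b d < 0).
- have [k|k|k] := ltrgtP (orient a b c) 0; [right|left|].
  + by split => //; rewrite -(nmulr_rgt0 _ k).
  + by split => //; rewrite -(pmulr_rgt0 _ k).
  + by move: h; rewrite -!/(orient _ _ _) k mul0r ltxx.
(* The linear part of [orient a b], constant on the line [a b]. *)
- exists (- (b.2 - a.2)), (b.1 - a.1); move: h1; rewrite /orient /= => -[? ?].
  by split; nra.
- exists (b.2 - a.2), (- (b.1 - a.1)); move: h1; rewrite /orient /= => -[? ?].
  by split; nra.
Qed.

Definition disjoint_segs a b c d := forall e, on_seg a b e -> on_seg c d e -> False.

Lemma disjoint_segsC a b c d : disjoint_segs a b c d -> disjoint_segs c d a b.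
Proof. by move=> h e h1 h2; exact: (h e). Qed.

Lemma neq_sqr_gt0 a b : a <> b -> 0 < (b.1 - a.1) ^+ 2 + (b.2 - a.2) ^+ 2.
Proof.
move=> ab; rewrite lt_neqAle addr_ge0 ?sqr_ge0 // andbT eq_sym.
rewrite paddr_eq0 ?sqr_ge0 // !sqrf_eq0 !subr_eq0; apply/negP => /andP[/eqP h1 /eqP h2].
by apply: ab; rewrite [a]surjective_pairing [b]surjective_pairing h1 h2.
Qed.

(** With [a] and [b] at parameters 0 and 1, the parameters [s] and [t] of [c] and [d] lie on the
    same side of the unit interval; the projection on the line then separates. *)
Lemma separated_collinear a b c d : a <> b ->
  orient a b c = 0 -> orient a b d = 0 -> disjoint_segs a b c d -> separated a b c d.
Proof.
move=> ab /(orient0_lin ab)[s ->] /(orient0_lin ab)[t ->] dis.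
have n0 := neq_sqr_gt0 ab; clear ab; set n := _ + _ in n0.
have hs : ~ (0 <= s <= 1).
  move=> h; apply: (dis (lin s a b)); first by apply/on_segP; exists s.
  by apply/on_segP; exists 0; rewrite ?lin0 // lexx ler01.
have ht : ~ (0 <= t <= 1).
  move=> h; apply: (dis (lin t a b)); first by apply/on_segP; exists t.
  by apply/on_segP; exists 1; rewrite ?lexx ?ler01 // [RHS]lin_sym subrr lin0.
have aab : on_seg a b a by apply/on_segP; exists 0; rewrite ?lin0 // lexx ler01.
have hst : s * t < 0 -> False.
  move=> st; have /andP[r0 r1] := ratio01 st.
  apply: (dis a) => //; apply/on_segP; exists (s / (s - t)); first by rewrite !ltW.
  have D0 : s - t != 0 by apply/eqP => h; nra.
  by rewrite [a]surjective_pairing /lin /=; congr pair; field.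
have fE r : let f p := (b.1 - a.1) * p.1 + (b.2 - a.2) * p.2 in
    f (lin r a b) = f a + r * n by rewrite /n /lin /=; ring.
have fb : (b.1 - a.1) * b.1 + (b.2 - a.2) * b.2 =
    (b.1 - a.1) * a.1 + (b.2 - a.2) * a.2 + n by rewrite /n; ring.
have [[s1 t1]|[s0 t0]] : (1 < s /\ 1 < t) \/ (s < 0 /\ t < 0).
  have [s0|s0] := ltP s 0; have [t0|t0] := ltP t 0.
  - by right.
  - by case: ht; rewrite t0 /= leNgt; apply/negP => t1; apply: hst; nra.
  - by case: hs; rewrite s0 /= leNgt; apply/negP => t1; apply: hst; nra.
  - left; rewrite !ltNge; split; apply/negP => h; [apply: hs|apply: ht]; exact/andP.
- exists (b.1 - a.1), (b.2 - a.2); move: (fE s) (fE t); rewrite /= => e1 e2.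
  by split; nra.
- exists (- (b.1 - a.1)), (- (b.2 - a.2)); move: (fE s) (fE t); rewrite /= => e1 e2.
  by split; nra.
Qed.

(** If the line of one segment misses the other, its normal separates them. Otherwise the lines meet
    in a point of both segments, or all orientations vanish; this leaves collinear segments and two
    single points. *)
Lemma disjoint_separated a b c d : disjoint_segs a b c d -> separated a b c d.
Proof.
move=> dis; have [h|h1] := ltP 0 (orient a b c * orient a b d).
  exact: separated_side.
have [h|h2] := ltP 0 (orient c d a * orient c d b).
  exact/separatedC/separated_side.
have [e1|ne] := eqVneq (orient a b c) (orient a b d); last first.
  have ratio (x y : R) : x * y <= 0 -> x != y -> 0 <= x / (x - y) <= 1.
    move=> xy; rewrite -subr_eq0; have [D|D|//] := ltrgtP (x - y) 0 => _.
    - by rewrite nmulr_lge0 ?invr_lt0 // ler_ndivrMr // mul1r; nra.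
    - by rewrite pmulr_lge0 ?invr_gt0 // ler_pdivrMr // mul1r; nra.
  have ne' : orient c d a != orient c d b.
    apply: contraNneq ne => E; have := orient_diff a b c d.
    by rewrite E subrr => /eqP; rewrite subr_eq0.
  case: (dis (lin (orient a b c / (orient a b c - orient a b d)) c d)); apply/on_segP.
    by rewrite lines_meet //; eexists; last reflexivity; exact: ratio.
  by eexists; last reflexivity; exact: ratio.
have o1 : orient a b c = 0 by nra.
have o2 : orient a b d = 0 by rewrite -e1.
have e2 : orient c d a = orient c d b.
  by have := orient_diff a b c d; rewrite o1 o2; lra.
have o3 : orient c d a = 0 by nra.
have o4 : orient c d b = 0 by rewrite -e2.
have [?|/eqP ab] := eqVneq a b; last exact: separated_collinear.
have [?|/eqP cd] := eqVneq c d.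
  subst b d; have ac : a <> c.
    move=> ac; subst c; apply: (dis a); apply/on_segP; exists 0; rewrite ?lin0 ?lexx ?ler01 //.
  have n0 := neq_sqr_gt0 ac; clear ac.
  exists (c.1 - a.1), (c.2 - a.2); rewrite /=; split; nra.
by apply/separatedC/separated_collinear => //; exact: disjoint_segsC.
Qed.

Lemma separated_ncross a b c d : separated a b c d -> ~~ cross a b c d.
Proof.
move=> [x [y [/= h1 h2 h3 h4]]]; apply/negP => /cross_point[r [s [r01 s01]]].
case=> e1 e2.
have e3 : x * ((1 - s) * c.1 + s * d.1) + y * ((1 - s) * c.2 + s * d.2) =
  x * ((1 - r) * a.1 + r * b.1) + y * ((1 - r) * a.2 + r * b.2) by rewrite e1 e2.
set fa := x * a.1 + y * a.2 in h1 h2; set fb := x * b.1 + y * b.2 in h3 h4.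
set fc := x * c.1 + y * c.2 in h1 h3; set fd := x * d.1 + y * d.2 in h2 h4.
have {e3} : (1 - s) * fc + s * fd = (1 - r) * fa + r * fb by rewrite /fa /fb /fc /fd; lra.
by case: (leP fa fb) => ?; nra.
Qed.

(** Each vertex moves by [t] times a point of the parabola, with its rank as parameter. All
    requirements are finitely many and hold for small positive [t]. *)
Lemma perturbation (V : finType) (pos : V -> point R) : exists P : V -> point R,
  [/\ general_position P, injective (fun v => (P v).1) &
    forall a b c d : V, disjoint_segs (pos a) (pos b) (pos c) (pos d) ->
      ~~ vcross P a b c d].
Proof.
pose r (v : V) : R := (enum_rank v)%:R.
have r_neq u v : u != v -> r u - r v != 0.
  move=> uv; rewrite subr_eq0 eqr_nat; apply: contra uv => /eqP h.
  by apply/eqP/enum_rank_inj/val_inj.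
pose P t v : point R := ((pos v).1 + t * r v, (pos v).2 + t * r v ^+ 2).
have s1 : near0 (fun t => forall a b c : V, a != b -> b != c -> a != c ->
    orient (P t a) (P t b) (P t c) != 0).
  apply: near0_all => a; apply: near0_all => b; apply: near0_all => c.
  have [ab|_] := boolP (a != b); last exact: near0_true.
  have [bc|_] := boolP (b != c); last exact: near0_true.
  have [ac|_] := boolP (a != c); last exact: near0_true.
  (* The coefficient of [t ^+ 2] in the orientation is this Vandermonde determinant. *)
  have V0 : (r b - r a) * (r c - r a) * (r c - r b) != 0.
    by rewrite !mulf_neq0 // r_neq // eq_sym.
  pose l := ((pos b).1 - (pos a).1) * (r c ^+ 2 - r a ^+ 2)
    + (r b - r a) * ((pos c).2 - (pos a).2)
    - ((pos b).2 - (pos a).2) * (r c - r a)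
    - (r b ^+ 2 - r a ^+ 2) * ((pos c).1 - (pos a).1).
  apply: near0_sub (@near0_quadratic (orient (pos a) (pos b) (pos c)) l
    ((r b - r a) * (r c - r a) * (r c - r b)) _); last first.
    by rewrite V0 !orbT.
  move=> t _ h _ _ _; congr (_ != 0): h.
  rewrite /orient /l /P /=.
  by case: (pos a) (pos b) (pos c) => [? ?] [? ?] [? ?] /=; ring.
have s2 : near0 (fun t => forall a b : V, a != b -> (P t a).1 - (P t b).1 != 0).
  apply: near0_all => a; apply: near0_all => b.
  have [ab|_] := boolP (a != b); last exact: near0_true.
  apply: near0_sub (@near0_quadratic ((pos a).1 - (pos b).1) (r a - r b) 0 _); last first.
    by rewrite r_neq // orbT.
  move=> t _ h _; congr (_ != 0): h; rewrite /P /=.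
  by case: (pos a) (pos b) => [? ?] [? ?] /=; ring.
have s3 : near0 (fun t => forall a b c d : V,
    disjoint_segs (pos a) (pos b) (pos c) (pos d) -> ~~ vcross (P t) a b c d).
  apply: near0_all => a; apply: near0_all => b.
  apply: near0_all => c; apply: near0_all => d.
  have [|nd] := pselect (disjoint_segs (pos a) (pos b) (pos c) (pos d)); last first.
    exact: near0_true.
  move=> /disjoint_separated[x [y [/= h1 h2 h3 h4]]].
  have sl u v : x * (pos u).1 + y * (pos u).2 < x * (pos v).1 + y * (pos v).2 ->
      near0 (fun t => x * (P t u).1 + y * (P t u).2 < x * (P t v).1 + y * (P t v).2).
    rewrite -subr_gt0 => h.
    pose k := x * (r v - r u) + y * (r v ^+ 2 - r u ^+ 2).
    apply: near0_sub (near0_gt0 k 0 h) => t _; rewrite -[in X in _ -> X]subr_gt0.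
    congr (0 < _); rewrite /k /P /=.
    by case: (pos u) (pos v) => [? ?] [? ?] /=; ring.
  apply: near0_sub (near0_and (near0_and (sl _ _ h1) (sl _ _ h2))
                              (near0_and (sl _ _ h3) (sl _ _ h4))).
  by move=> t _ [[? ?] [? ?]] _; apply: separated_ncross; exists x, y.
have [del del0 H] := near0_and s1 (near0_and s2 s3).
have [] := H (del / 2); first by rewrite divr_gt0 //= ltr_pdivrMr //; lra.
move=> gp [xi nc]; exists (P (del / 2)); split => // a b E.
have {}E : (P (del / 2) a).1 = (P (del / 2) b).1 by exact: E.
by apply/eqP; apply: contraT => /xi; rewrite E subrr eqxx.
Qed.

End Perturbation.

(** * Extension to maximal noncrossing sets *)

Section Saturation.
Variables (R : realType) (V : finType) (P : V -> point R).

Lemma saturation (E : {set V * V}) :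
    (forall a b, (a, b) \in E -> a != b) -> noncrossing P E ->
  exists T : {set V * V}, [/\ E \subset T, forall a b, (a, b) \in T -> a != b,
    noncrossing P T & saturated P T].
Proof.
move=> E_irr E_nc.
pose ok (T : {set V * V}) := [forall e in T, e.1 != e.2] &&
  [forall e in T, forall f in T, ~~ vcross P e.1 e.2 f.1 f.2].
have okP (T : {set V * V}) : reflect
    ((forall a b, (a, b) \in T -> a != b) /\ noncrossing P T) (ok T).
  apply: (iffP andP) => -[h1 h2]; split.
  - by move=> a b ab; exact: (forall_inP h1 _ ab).
  - move=> a b c d ab cd; exact: (forall_inP (forall_inP h2 _ ab) _ cd).
  - by apply/forall_inP => -[a b]; exact: h1.
  - by apply/forall_inP => -[a b] ab; apply/forall_inP => -[c d]; exact: h2.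
have /maxset_exists[T /maxsetP[/okP[T_irr T_nc] Tmax] ET] : ok E by apply/okP.
exists T; split => // a b ab nab.
have self p q : ~~ vcross P p q p q.
  by rewrite /vcross /cross orient_xyx mul0r ltxx.
suff /Tmax <- : ok ((a, b) |: T); rewrite ?subsetUr ?setU11 //.
apply/okP; split=> [c d|c d p q]; rewrite !in_setU1.
  by move=> /predU1P[[-> ->] //|]; exact: T_irr.
move=> /predU1P[[-> ->]|cd] /predU1P[[-> ->]|pq] //; try exact: nab.
- by rewrite /vcross crossC; exact: nab.
- exact: T_nc.
Qed.

(** No segment has ends strictly on both sides of the line, so nothing can block [a b]. *)
Lemma hull_edge (T : {set V * V}) a b : saturated P T -> a != b ->
  (forall s, orient (P a) (P b) (P s) <= 0) -> (a, b) \in T.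
Proof.
move=> T_max ab h; apply: T_max => // c d _; apply/negP => /andP[+ _].
by rewrite ltNge mulr_le0.
Qed.

End Saturation.

(** * Lower and upper bounds for complete bipartite graphs *)

Definition red m n (v : 'I_m + 'I_n) : bool := if v is inl _ then true else false.

Lemma Kmn_adjE m n u v : Kmn_adj m n u v = (red u != red v).
Proof. by case: u; case: v. Qed.

Lemma two_layers_bound (R : realType) (m n k : nat) : (k <= 2)%N -> (2 < m + n)%N ->
  geom_drawable R (Kmn_adj m n) k -> (m * n + 10 <= 4 * (m + n))%N.
Proof.
move=> k2 mn2 [pos [layer [_ [layC [_ nocross]]]]].
set V := ('I_m + 'I_n)%type in pos layer layC nocross.
have cardV : #|{: V}| = (m + n)%N by rewrite card_sum !card_ord.
have [P [gp x_inj P_nc]] := perturbation pos.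
have adjC u v : Kmn_adj m n u v = Kmn_adj m n v u by rewrite !Kmn_adjE eq_sym.
(* Layers are compared as natural numbers, so that 0 and 1 can be named for every [k <= 2]; a
   missing layer gives the empty set. *)
pose E l := [set e : V * V | Kmn_adj m n e.1 e.2 && (layer e.1 e.2 == l :> nat)].
have E_irr l a b : (a, b) \in E l -> a != b.
  by rewrite inE Kmn_adjE => /andP[+ _]; apply: contraNneq => ->.
have E_nc l : noncrossing P (E l).
  move=> a b c d; rewrite !inE /= => /andP[ab /eqP lab] /andP[cd /eqP lcd].
  have lay : layer a b = layer c d by apply: val_inj; rewrite /= lab lcd.
  have [/eqP ->|ac] := boolP (a == c).
    by rewrite /vcross /cross orient_xyx mul0r ltxx.
  have [/eqP ->|ad] := boolP (a == d).
    by rewrite /vcross /cross orient_xyx mulr0 ltxx.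
  have [/eqP ->|bc] := boolP (b == c).
    by rewrite /vcross /cross orient_xyy mul0r ltxx.
  have [/eqP ->|bd] := boolP (b == d).
    by rewrite /vcross /cross orient_xyy mulr0 ltxx.
  apply: P_nc => e e1 e2.
  have nsame : ~ ((a = c /\ b = d) \/ (a = d /\ b = c)).
    by case=> -[/eqP h _]; [rewrite h in ac|rewrite h in ad].
  have [w [wab [wcd _]]] := nocross _ _ _ _ ab cd nsame lay _ e1 e2.
  by move: ac ad bc bd; case: wab wcd => <- [] <-; rewrite eqxx.
have [T0 [ET0 T0_irr T0_nc T0_max]] := saturation (E_irr 0%N) (E_nc 0%N).
have [T1 [ET1 T1_irr T1_nc T1_max]] := saturation (E_irr 1%N) (E_nc 1%N).
pose left u v := [exists s, 0 < orient (P u) (P v) (P s)].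
pose D0 := [set e : V * V | [&& e \in T0, red e.1, ~~ red e.2 & left e.1 e.2]].
pose D1 := [set e : V * V | [&& e \in T1, ~~ red e.1, ~~ ~~ red e.2 & left e.1 e.2]].
have V3 : (2 < #|{: V}|)%N by rewrite cardV.
have D0_le : (#|D0| + 5 <= #|{: V}| * 2)%N.
  apply: (directed_edges_bound gp x_inj T0_irr T0_nc T0_max (col := @red m n) V3).
  by move=> u v; rewrite inE => /and4P[? ? ? /existsP].
have D1_le : (#|D1| + 5 <= #|{: V}| * 2)%N.
  apply: (directed_edges_bound gp x_inj T1_irr T1_nc T1_max
    (col := fun v => ~~ @red m n v) V3).
  by move=> u v; rewrite inE => /and4P[? ? ? /existsP].
have left_either u v : u != v -> ~~ left u v -> left v u.
  move=> uv /existsPn nl.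
  have [s /andP[su sv]] := exists_notin_pair u v V3; apply/existsP; exists s.
  have o0 : orient (P u) (P v) (P s) != 0 by apply: gp; rewrite // eq_sym.
  by rewrite orient_swap oppr_gt0 lt_neqAle o0 leNgt nl.
have no_left u v : ~~ left u v -> forall s, orient (P u) (P v) (P s) <= 0.
  by move=> /existsPn h s; rewrite leNgt h.
pose g (ij : 'I_m * 'I_n) : V * V := (inl ij.1, inr ij.2).
have g_inj : injective g by move=> [i j] [i' j'] [-> ->].
(* Edges in [D1] run from blue to red and are reversed before the union is taken. *)
pose sw (e : V * V) := (e.2, e.1).
have : [set g x | x in predT] \subset D0 :|: [set sw e | e in D1].
  apply/subsetP => _ /imsetP[[i j] _ ->]; rewrite /g /=.
  set r : V := inl i; set b : V := inr j.
  have rb : r != b by []; have br : b != r by [].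
  have inD1 : (b, r) \in T1 -> left b r -> (r, b) \in D0 :|: [set sw e | e in D1].
    move=> h1 h2; rewrite inE; apply/orP; right; apply/imsetP; exists (b, r) => //.
    by rewrite inE h1 h2.
  have inD0 : (r, b) \in T0 -> left r b -> (r, b) \in D0 :|: [set sw e | e in D1].
    by move=> h1 h2; rewrite inE; apply/orP; left; rewrite inE h1 h2.
  (* An edge with no point on one side lies in both triangulations, so it is counted from its other
     side whatever its layer. *)
  have [lrb|nrb] := boolP (left r b); last first.
    apply: inD1; last exact: left_either nrb.
    apply: (T_sym T1_irr T1_nc T1_max); exact: hull_edge (no_left _ _ nrb).
  have [lbr|nbr] := boolP (left b r); last first.
    apply: inD0 => //.
    apply: (T_sym T0_irr T0_nc T0_max); exact: hull_edge (no_left _ _ nbr).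
  have : (layer r b < 2)%N by exact: leq_trans (ltn_ord _) k2.
  case l : (nat_of_ord (layer r b)) => [|[|//]] _.
  - by apply: inD0 => //; apply: (subsetP ET0); rewrite inE /= l.
  - by apply: inD1 => //; apply: (subsetP ET1); rewrite inE /= -layC // l.
move=> /subset_leq_card; rewrite card_imset // => h1.
have h2 : (#|D0 :|: [set sw e | e in D1]| <= #|D0| + #|D1|)%N.
  by rewrite (leq_trans (leq_card_setU _ _)) // leq_add2l leq_imset_card.
have h3 : #|predT : pred ('I_m * 'I_n)| = (m * n)%N by rewrite card_prod !card_ord.
by rewrite h3 in h1; rewrite cardV in D0_le D1_le; lia.
Qed.

(** Blue vertices lie on the horizontal axis, red ones in two rows at heights 1 and -1. Each layer
    consists of the stars of at most one red vertex from each row, and stars from opposite rows meet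
    only on the axis. *)
Lemma Kmn_drawable (R : realType) (m n k : nat) : (0 < k)%N -> (m <= k.*2)%N ->
  geom_drawable R (Kmn_adj m n) k.
Proof.
case: k => // k _ mk.
(* There are now [k.+1] layers, so the indices from 0 to [k] form the upper row. *)
pose ht (i : 'I_m) : R := (-1) ^+ (k < i)%N.
pose pos (v : 'I_m + 'I_n) : point R :=
  match v with inl i => (i%:R, ht i) | inr j => (j%:R, 0) end.
pose layer (u v : 'I_m + 'I_n) : 'I_k.+1 :=
  match u, v with
  | inl i, inr _ | inr _, inl i => inord (i %% k.+1)
  | _, _ => ord0
  end.
have ht0 i : ht i != 0 by rewrite /ht signr_eq0.
have on_edge i j x : on_seg (pos (inl i)) (pos (inr j)) x ->
    exists2 t, 0 <= t <= 1 & x = ((1 - t) * i%:R + t * j%:R, (1 - t) * ht i).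
  move=> /on_segP[t tb ->]; exists t => //; rewrite /lin /=; congr pair; ring.
have nat_inj (p q : nat) : p%:R = q%:R :> R -> p = q by move/eqP; rewrite eqr_nat => /eqP.
have no_vertex i j w : w <> inl i -> w <> inr j ->
    ~ on_seg (pos (inl i)) (pos (inr j)) (pos w).
  move=> wi wj /on_edge[t tb]; case: w wi wj => [i'|j'] wi wj /= [ex ey].
  - have t0 : t = 0.
      by move: ey; rewrite /ht; case: (k < i')%N; case: (k < i)%N;
        rewrite ?expr0 ?expr1 => ey; lra.
    by case: wi; congr inl; apply/val_inj/nat_inj; rewrite ex t0; ring.
  - have t1 : t = 1.
      by move/esym/eqP: ey; rewrite mulf_eq0 (negPf (ht0 i)) orbF subr_eq0 => /eqP.
    by case: wj; congr inr; apply/val_inj/nat_inj; rewrite ex t1; ring.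
have meet (i i' : 'I_m) (j j' : 'I_n) x :
    ~ (i = i' /\ j = j') -> (i %% k.+1 = i' %% k.+1)%N ->
    on_seg (pos (inl i)) (pos (inr j)) x -> on_seg (pos (inl i')) (pos (inr j')) x ->
    (i = i' /\ x = pos (inl i)) \/ (j = j' /\ x = pos (inr j)).
  move=> ne imod /on_edge[t tb ->] /on_edge[t' tb' [ex ey]].
  have [ii'|ii'] := eqVneq i i'.
    subst i'; left; split => //.
    have tt : t = t' by have /(mulIf (ht0 i)) := ey; lra.
    have jj : j%:R - j'%:R != 0 :> R.
      by rewrite subr_eq0 eqr_nat; apply/eqP => /val_inj jj; apply: ne.
    have t0 : t = 0.
      have /eqP : t * (j%:R - j'%:R) = 0 by rewrite -tt in ex; lra.
      by rewrite mulf_eq0 (negPf jj) orbF => /eqP.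
    by rewrite t0 /=; congr pair; ring.
  (* Distinct indices below [k.+1.*2] with equal residues differ by [k.+1], hence lie in different
     rows. *)
  have hts : ht i' = - ht i.
    have : (k < i')%N = ~~ (k < i)%N.
      have hi := ltn_ord i; have hi' := ltn_ord i'.
      have : (i : nat) <> i' by move/val_inj/eqP; rewrite (negPf ii').
      have modE p : (p < k.+1.*2)%N -> (p %% k.+1 = if k < p then p - k.+1 else p)%N.
        have [kp p2|pk _] := ltnP k p; last by rewrite modn_small.
        by rewrite -[in LHS](subnK kp) modnDr modn_small //; lia.
      move: imod; rewrite !modE; [|lia|lia].
      by case: (ltnP k i); case: (ltnP k i'); lia.
    by rewrite /ht => ->; case: (k < i)%N; rewrite ?expr0 ?expr1 ?opprK.
  (* The ordinate of the common point has both weak signs, so the point is on the axis. *)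
  have tt : t = 1 /\ t' = 1.
    have /(mulIf (ht0 i)) : (1 - t) * ht i = - (1 - t') * ht i by rewrite ey hts; ring.
    by move=> e; split; lra.
  have [t1 t1'] := tt; right; rewrite t1 t1' in ex *.
  split; first by apply/val_inj/nat_inj; lra.
  by rewrite /=; congr pair; ring.
exists pos, layer; split; last split; last split.
- move=> [i|j] [i'|j'] e; have /= ey := congr1 snd e; have /= ex := congr1 fst e.
  + by congr inl; apply/val_inj/nat_inj.
  + by move: (ht0 i); rewrite ey eqxx.
  + by move: (ht0 i'); rewrite -ey eqxx.
  + by congr inr; apply/val_inj/nat_inj.
- by move=> [i|j] [i'|j'].
- move=> [i|j] [i'|j'] w //= _ h1 h2; first exact: no_vertex.
  by move/on_segC; exact: no_vertex.
- have main (i i' : 'I_m) (j j' : 'I_n) x : ~ (i = i' /\ j = j') ->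
      layer (inl i) (inr j) = layer (inl i') (inr j') ->
      on_seg (pos (inl i)) (pos (inr j)) x -> on_seg (pos (inl i')) (pos (inr j')) x ->
      (inl i = inl i' :> 'I_m + 'I_n /\ x = pos (inl i)) \/
      (inr j = inr j' :> 'I_m + 'I_n /\ x = pos (inr j)).
    move=> ne /(congr1 val); rewrite /= !inordK ?ltn_pmod // => lay h1 h2.
    by case: (meet _ _ _ _ _ ne lay h1 h2) => -[-> ->]; [left|right].
  have sym u v : layer u v = layer v u by case: u => ?; case: v.
  move=> a b c d; wlog: a b / red a => [H|ra].
    move=> ab cd ne lab x h1 h2; have [ra|nra] := boolP (red a); first exact: H lab x h1 h2.
    have rb : red b by move: ab; rewrite Kmn_adjE (negPf nra); case: (red b).
    have [|||w [w1 w2]] := H b a rb _ cd _ _ x (on_segC h1) h2.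
    + by rewrite Kmn_adjE eq_sym -Kmn_adjE.
    + by move=> h; apply: ne; tauto.
    + by rewrite sym.
    + by exists w; split => //; case: w1; [right|left].
  wlog: c d / red c => [H|rc].
    move=> ab cd ne lab x h1 h2; have [rc|nrc] := boolP (red c); first exact: H lab x h1 h2.
    have rd : red d by move: cd; rewrite Kmn_adjE (negPf nrc); case: (red d).
    have [|||w [w1 [w2 w3]]] := H d c rd ab _ _ _ x h1 (on_segC h2).
    + by rewrite Kmn_adjE eq_sym -Kmn_adjE.
    + by move=> h; apply: ne; tauto.
    + by rewrite lab sym.
    + by exists w; split => //; split => //; case: w2; [right|left].
  case: a b c d ra rc => [i|//] [//|j] [i'|//] [//|j'] _ _ _ _ ne lay x h1 h2.
  have ne' : ~ (i = i' /\ j = j') by move=> [ii jj]; apply: ne; left; rewrite ii jj.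
  case: (main _ _ _ _ _ ne' lay h1 h2) => -[E xE].
  + by exists (inl i); split; [left|split => //; left].
  + by exists (inr j); split; [right|split => //; right].
Qed.

Theorem theorem5p3 (R : realType) :
  is_geometric_thickness R (Kmn_adj 6 8) 3.
Proof.
split; first exact: Kmn_drawable.
move=> j dr; rewrite leqNgt; apply/negP; rewrite ltnS => j2.
(* The bound would read [58 <= 56]. *)
by have := two_layers_bound j2 (isT : (2 < 6 + 8)%N) dr.
Qed.
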